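(* Let $G$ be a finite connected loopless undirected multigraph of genus $g=|E(G)|-|V(G)|+1$. Then $\mathrm{Pic}^{g-1}(G)$ is canonically isomorphic, as a $\mathrm{Pic}^0(G)$-torsor, to the set of full orientations of $G$ modulo cut and cycle reversals, acted on by path reversals.
   Context: A divisor on $G$ is a function $D:V(G)\to\mathbb{Z}$, also written as a formal integer sum of vertices $(v)$; $\deg(D)=\sum_v D(v)$. Two divisors are linearly equivalent if their difference lies in the $\mathbb{Z}$-span of the columns of the Laplacian matrix of $G$. $\mathrm{Pic}^d(G)$ is the set of divisors of degree $d$ modulo linear equivalence; $\mathrm{Pic}^0(G)$ is a group under addition and acts on $\mathrm{Pic}^{g-1}(G)$ by addition. For a group $H$, an $H$-torsor is a set equipped with a simply transitive action of $H$. A full orientation of $G$ assigns a direction to every edge. A cycle reversal reverses all edges of a directed cycle. A cut (cocycle) reversal reverses all edges of a cut $(X,X^c)$ all of whose edges are oriented in the same direction across the cut. Full orientations modulo cut and cycle reversals are the equivalence classes generated by these two moves; the class of $\mathcal{O}$ is written $[\mathcal{O}]$. An orientation is $q$-connected if there is a directed path from the vertex $q$ to every other vertex. ''Acted on by path reversals'' refers to the following action of $\mathrm{Pic}^0(G)$: for vertices $p,q$, the divisor $(q)-(p)$ sends $[\mathcal{O}]$ to the class of the orientation obtained from a $q$-connected orientation in $[\mathcal{O}]$ by reversing a directed path from $q$ to $p$; this is extended by linearity to all divisors of degree $0$. *)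

(* Defs.v *)
From HB Require Import structures.
From mathcomp Require Import all_boot all_order all_algebra.
From mathcomp Require Import generic_quotient ring_quotient.
From mathcomp Require Import boolp.

Set Implicit Arguments.
Unset Strict Implicit.
Unset Printing Implicit Defensive.

Import GRing.Theory Num.Theory Quotient.

Local Open Scope ring_scope.
Local Open Scope quotient_scope.

(* Finite loopless undirected multigraphs: each edge has a 2-element set of
   endpoints, and distinct edges may share the same endpoints. *)
Record multigraph := Multigraph {
  vert : finType;
  edge : finType;
  ends : edge -> {set vert};
  card_ends : forall e, #|ends e| = 2%N
}.

Section Graph.
Variable G : multigraph.
Local Notation V := (vert G).
Local Notation E := (edge G).

Definition adj : rel V := [rel u v | [exists e : E, ends e == [set u; v]]].

Definition connected : Prop :=
  (0 < #|V|)%N /\ forall u v : V, connect adj u v.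

Definition genus : int := #|E|%:Z - #|V|%:Z + 1.

Definition divisor := {ffun V -> int}.
HB.instance Definition _ := GRing.Zmodule.on divisor.

Definition vdiv (v : V) : divisor := [ffun u => (u == v)%:Z].

Definition deg (D : divisor) : int := \sum_v D v.

Definition valency (v : V) : nat := #|[set e : E | v \in ends e]|.

Definition laplacian (u v : V) : int :=
  if u == v then (valency v)%:Z
  else - #|[set e : E | ends e == [set u; v]]|%:Z.

Definition laplacian_col (v : V) : divisor := [ffun u => laplacian u v].

Definition principal : {pred divisor} := fun D =>
  `[< exists f : V -> int, D = \sum_v laplacian_col v *~ f v >].

Lemma principal_zmod_closed : zmod_closed principal.
Proof.
split.
  by apply/asboolP; exists (fun=> 0); rewrite big1.
move=> D D' /asboolP [f ->] /asboolP [f' ->]; apply/asboolP.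
exists (fun v => f v - f' v).
by rewrite -sumrB; apply: eq_bigr => v _; rewrite mulrzBr.
Qed.

HB.instance Definition _ :=
  GRing.isZmodClosed.Build divisor principal principal_zmod_closed.

(* divisors of all degrees modulo linear equivalence; see Pic d below *)
Definition picard := {quot principal}.
HB.instance Definition _ := GRing.Zmodule.on picard.

Definition div_class (D : divisor) : picard := \pi_picard D.

Definition has_degree (d : int) : {pred picard} :=
  fun x => `[< exists2 D, deg D = d & div_class D = x >].

Definition Pic (d : int) := {x : picard | has_degree d x}.

Lemma div_classB D D' : div_class (D - D') = div_class D - div_class D'.
Proof. exact: raddfB. Qed.

Lemma div_classD D D' : div_class (D + D') = div_class D + div_class D'.
Proof. exact: raddfD. Qed.

Lemma degB D D' : deg (D - D') = deg D - deg D'.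
Proof. by rewrite /deg -sumrB; apply: eq_bigr => v _; rewrite !ffunE. Qed.

Lemma degD D D' : deg (D + D') = deg D + deg D'.
Proof. by rewrite /deg -big_split; apply: eq_bigr => v _; rewrite ffunE. Qed.

Lemma deg_vdiv v : deg (vdiv v) = 1.
Proof.
rewrite /deg (bigD1 v) //= big1 => [|u /negPf uv]; rewrite ffunE ?eqxx //.
by rewrite uv.
Qed.

Lemma has_degree0_zmod_closed : zmod_closed (has_degree 0).
Proof.
split.
  apply/asboolP; exists 0; last exact: raddf0.
  by rewrite /deg big1 // => v _; rewrite ffunE.
move=> x y /asboolP [D dD <-] /asboolP [D' dD' <-]; apply/asboolP.
by exists (D - D'); [rewrite degB dD dD' subrr | exact: div_classB].
Qed.

HB.instance Definition _ :=
  GRing.isZmodClosed.Build picard (has_degree 0) has_degree0_zmod_closed.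

Definition Pic0 := Pic 0.
HB.instance Definition _ := SubChoice.on Pic0.
HB.instance Definition _ := [SubChoice_isSubZmodule of Pic0 by <:].

Lemma has_degree_class d D : deg D = d -> has_degree d (div_class D).
Proof. by move=> dD; apply/asboolP; exists D. Qed.

Definition pic_class d D (dD : deg D = d) : Pic d :=
  exist _ (div_class D) (has_degree_class dD).

Lemma deg_vdivB q p : deg (vdiv q - vdiv p) = 0.
Proof. by rewrite degB !deg_vdiv subrr. Qed.

Definition vdiff (q p : V) : Pic0 := pic_class (deg_vdivB q p).

Lemma has_degree_add d (a : Pic0) (x : Pic d) :
  has_degree d (sval a + sval x).
Proof.
case: a x => [_ /= /asboolP [A dA <-]] [_ /= /asboolP [D dD <-]].
apply/asboolP; exists (A + D); last exact: div_classD.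
by rewrite degD dA dD add0r.
Qed.

Definition pic_act d (a : Pic0) (x : Pic d) : Pic d :=
  exist _ (sval a + sval x) (has_degree_add a x).

(* arc e = (tail, head) *)
Record orientation := Orientation {
  arc : {ffun E -> V * V};
  arcP : [forall e, ends e == [set (arc e).1; (arc e).2]]
}.

HB.instance Definition _ := [isSub for arc].
HB.instance Definition _ := [Finite of orientation by <:].

Definition tail (O : orientation) (e : E) : V := (arc O e).1.
Definition head (O : orientation) (e : E) : V := (arc O e).2.

Definition swap_arcs (O : orientation) (S : {set E}) : {ffun E -> V * V} :=
  [ffun e => if e \in S then (head O e, tail O e) else (tail O e, head O e)].

Lemma swap_arcsP O S :
  [forall e, ends e == [set (swap_arcs O S e).1; (swap_arcs O S e).2]].
Proof.
apply/forallP => e; rewrite ffunE (eqP (forallP (arcP O) e)).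
by case: ifP => _ //=; rewrite setUC.
Qed.

Definition reverse (O : orientation) (S : {set E}) : orientation :=
  Orientation (swap_arcsP O S).

(* the edges of c, in this order, form a directed cycle of O *)
Definition dicycle (O : orientation) (c : seq E) : bool :=
  [&& c != [::], cycle (fun e f => head O e == tail O f) c
    & uniq [seq tail O e | e <- c]].

Definition cycle_reversal (O O' : orientation) : bool :=
  `[< exists2 c, dicycle O c & O' = reverse O [set e in c] >].

Definition cut (X : {set V}) : {set E} :=
  [set e | (ends e :&: X != set0) && (ends e :&: ~: X != set0)].

(* One direction suffices: X and ~: X have the same cut. *)
Definition dicut (O : orientation) (X : {set V}) : bool :=
  [&& X != set0, ~: X != set0 & [forall e in cut X, tail O e \in X]].

Definition cut_reversal (O O' : orientation) : bool :=
  [exists X, dicut O X && (O' == reverse O (cut X))].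

Definition move (O O' : orientation) : bool :=
  cycle_reversal O O' || cut_reversal O O'.

Definition reversal_equiv : rel orientation :=
  connect [rel O O' | move O O' || move O' O].

Lemma reversal_equiv_class : equiv_class_of reversal_equiv.
Proof.
split; [exact: connect0 | | exact: connect_trans].
by apply: sym_connect_sym => O O' /=; rewrite orbC.
Qed.

Canonical reversal_equivRel := EquivRelPack reversal_equiv_class.
Canonical reversal_encModRel := defaultEncModRel reversal_equiv.

Definition orientation_class := {eq_quot reversal_equiv}.

Definition or_class (O : orientation) : orientation_class :=
  \pi_orientation_class O.

(* the edges of p, in this order, form a directed path of O from u to v;
   the empty path is allowed when u = v *)
Definition dipath (O : orientation) (u v : V) (p : seq E) : bool :=
  [&& [seq tail O e | e <- p] == belast u [seq head O e | e <- p],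
      last u [seq head O e | e <- p] == v
    & uniq (u :: [seq head O e | e <- p])].

Definition qconnected (q : V) (O : orientation) : Prop :=
  forall v : V, exists p, dipath O q v p.

Definition indeg (O : orientation) (v : V) : nat :=
  #|[set e | head O e == v]|.

Definition orientation_divisor (O : orientation) : divisor :=
  [ffun v => (indeg O v)%:Z - 1].

Lemma deg_orientation_divisor O : deg (orientation_divisor O) = genus - 1.
Proof.
have -> : genus - 1 = #|E|%:Z - #|V|%:Z by rewrite /genus addrK.
have -> : deg (orientation_divisor O) = \sum_v (indeg O v)%:Z - \sum_(v : V) 1.
  by rewrite -sumrB; apply: eq_bigr => v _; rewrite ffunE.
congr (_ - _); last by rewrite sumr_const natz.
rewrite -(eq_bigr _ (fun v _ => natz (indeg O v))) -natr_sum natz; congr Posz.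
rewrite -sum1_card (partition_big (head O) xpredT) //=.
by apply: eq_bigr => v _; rewrite sum1dep_card.
Qed.

Definition orientation_pic (O : orientation) : Pic (genus - 1) :=
  pic_class (deg_orientation_divisor O).

End Graph.

Section Torsor.
Variable H : zmodType.

Definition group_action (X : Type) (act : H -> X -> X) : Prop :=
  (forall x, act 0 x = x) /\
  (forall a b x, act (a + b) x = act a (act b x)).

(* As usual a torsor is nonempty. *)
Definition torsor (X : Type) (act : H -> X -> X) : Prop :=
  [/\ group_action act, inhabited X
    & forall x y, exists! a, act a x = y].

Definition torsor_iso (X Y : Type) (actX : H -> X -> X) (actY : H -> Y -> Y)
    (f : X -> Y) : Prop :=
  bijective f /\ forall a x, f (actX a x) = actY a (f x).

End Torsor.

(* Being a group action of Pic^0 encodes extension by linearity from the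
   differences (q) - (p), which generate the divisors of degree 0. *)
Definition path_reversal_action (G : multigraph)
    (act : Pic0 G -> orientation_class G -> orientation_class G) : Prop :=
  group_action act /\
  forall (q p : vert G) (O : orientation G) (s : seq (edge G)),
    qconnected q O -> dipath O q p s ->
    act (vdiff q p) (or_class O) = or_class (reverse O [set e in s]).

(* Main.v *)
(** Sending an orientation [O] to [indeg O - 1] intertwines the reversal of a
    directed path from [q] to [p] with addition of [(q) - (p)], so it suffices
    that this map induces a bijection from reversal classes to Pic^{g-1}.

    Surjectivity: reversing the cut around the set reachable from [q] until it
    exhausts the graph makes any orientation [q]-connected, and the differences
    [(q) - (p)] generate Pic^0.

    Injectivity: if [O] and [O'] have divisors differing by the Laplacian of an
    integer function [f], normalized to have minimum 0, then [f] drops by 0 or 1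
    along every edge of [O].  So the cut around [{f > 0}] is directed; reversing
    it replaces [f] by [max(f - 1, 0)].  Once [f] vanishes, the edges on which
    [O] and [O'] differ are balanced at every vertex, hence decompose into
    directed cycles. *)
From mathcomp Require Import all_boot all_order all_algebra.
From mathcomp Require Import generic_quotient ring_quotient boolp.
From mathcomp Require Import zify.
Require Import Defs.

Set Implicit Arguments.
Unset Strict Implicit.
Unset Printing Implicit Defensive.

Import Order.TTheory GRing.Theory Num.Theory Quotient.

Local Open Scope ring_scope.

Section Orientations.
Variable G : multigraph.
Implicit Types (O : orientation G) (e : edge G) (u v q : vert G).
Implicit Types (S : {set edge G}) (X : {set vert G}).

(** * Orientations of a fixed graph and reversal of edge sets *)

Lemma ends_arc O e : ends e = [set tail O e; head O e].
Proof. exact/eqP/(forallP (arcP O)). Qed.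

Lemma tail_neq_head O e : tail O e != head O e.
Proof. by have := card_ends e; rewrite (ends_arc O) cards2; case: eqP. Qed.

Lemma orientation_inj O O' :
  (forall e, tail O e = tail O' e) -> (forall e, head O e = head O' e) ->
  O = O'.
Proof.
move=> eqt eqh; apply/val_inj/ffunP => e /=.
have := eqt e; have := eqh e; rewrite /tail /head.
by case: (arc O e) => a b; case: (arc O' e) => c d /= -> ->.
Qed.

Lemma tail_reverse O S e :
  tail (reverse O S) e = if e \in S then head O e else tail O e.
Proof. by rewrite /tail ffunE; case: ifP. Qed.

Lemma head_reverse O S e :
  head (reverse O S) e = if e \in S then tail O e else head O e.
Proof. by rewrite /head ffunE; case: ifP. Qed.

Lemma reverse_sub O S S' : S \subset S' ->
  reverse (reverse O S) (S' :\: S) = reverse O S'.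
Proof.
move=> /subsetP sSS'; apply: orientation_inj => e;
  rewrite !(tail_reverse, head_reverse) !inE;
  by case: (boolP (e \in S)) => // /sSS' ->.
Qed.

Lemma arc_eq_or_swap O O' e :
  (tail O' e = tail O e /\ head O' e = head O e) \/
  (tail O' e = head O e /\ head O' e = tail O e).
Proof.
have th := tail_neq_head O' e.
have := set21 (tail O' e) (head O' e); have := set22 (tail O' e) (head O' e).
rewrite -ends_arc (ends_arc O) !inE.
by case/orP => /eqP hE /orP[] /eqP tE; move: th; rewrite hE tE ?eqxx //; auto.
Qed.

Lemma reverse_exists O O' : exists S, O' = reverse O S.
Proof.
exists [set e | tail O' e != tail O e]; apply: orientation_inj => e;
  rewrite !(tail_reverse, head_reverse) !inE;
  have [[tE hE]|[tE hE]] := arc_eq_or_swap O O' e;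
  by rewrite tE ?hE ?eqxx // eq_sym tail_neq_head.
Qed.

Lemma orientation_exists : inhabited (orientation G).
Proof.
have /choice[a Pa] : forall e : edge G, exists a, ends e == [set a.1; a.2].
  move=> e; have /eqP/cards2P[x [y [_ ->]]] := card_ends e.
  by exists (x, y).
have aP : [forall e, ends e == [set (finfun a e).1; (finfun a e).2]].
  by apply/forallP => e; rewrite ffunE.
by split; apply: Orientation aP.
Qed.

(** * Arc boundaries and the Laplacian *)

Definition boundary O e : divisor G := vdiv (tail O e) - vdiv (head O e).

Lemma sum_indic (T : finType) (P : pred T) :
  #|[set x | P x]|%:Z = \sum_x (P x)%:Z.
Proof.
rewrite -sum1dep_card -natz natr_sum big_mkcond.
by apply: eq_bigr => x _; case: (P x).
Qed.

(** Reversing an arc moves one unit of indegree from its head to its tail; this fixes the sign of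
    [boundary]. *)
Lemma orientation_divisor_reverse O S :
  orientation_divisor (reverse O S) =
  orientation_divisor O + \sum_(e in S) boundary O e.
Proof.
apply/ffunP => v; rewrite !ffunE sum_ffunE /indeg !sum_indic addrAC.
congr (_ - _); rewrite [X in _ + X]big_mkcond -big_split /=.
apply: eq_bigr => e _; rewrite head_reverse.
case: ifP => _; rewrite ?addr0 // !ffunE (eq_sym v) (eq_sym v).
by rewrite addrCA subrr addr0.
Qed.

(* The Laplacian is the product of the incidence matrix of an arbitrary
   orientation with its transpose. *)
Lemma laplacian_incidence O u v :
  laplacian u v = \sum_e boundary O e v * boundary O e u.
Proof.
rewrite /laplacian; case: eqP => [->|/eqP uv].
  rewrite /valency sum_indic; apply: eq_bigr => e _.
  rewrite !ffunE (ends_arc O) !inE; have := tail_neq_head O e.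
  by case: (v =P tail O e) => [->|_]; [case: eqP | case: (v =P head O e)].
rewrite sum_indic -sumrN; apply: eq_bigr => e _.
rewrite !ffunE; have th := tail_neq_head O e.
have -> : (ends e == [set u; v]) =
  (tail O e == u) && (head O e == v) || (tail O e == v) && (head O e == u).
  rewrite (ends_arc O); apply/eqP/orP => [eqs|[]/andP[/eqP-> /eqP->] //].
    have := set21 (tail O e) (head O e); have := set22 (tail O e) (head O e).
    rewrite eqs !inE => /orP[] /eqP hE /orP[] /eqP tE;
      by move: th; rewrite hE tE ?eqxx //; auto.
  by rewrite setUC.
move/eqP in uv; move/eqP in th.
case: (eqVneq v (tail O e)) => ?; case: (eqVneq v (head O e)) => ?;
  case: (eqVneq u (tail O e)) => ?; case: (eqVneq u (head O e)) => ? //;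
  congruence.
Qed.

Lemma boundary_pair O e (f : vert G -> int) :
  \sum_v boundary O e v * f v = f (tail O e) - f (head O e).
Proof.
have vdiv_pair w : \sum_v vdiv w v * f v = f w.
  rewrite (bigD1 w) //= big1 => [|v /negPf vw]; last by rewrite ffunE vw mul0r.
  by rewrite ffunE eqxx mul1r addr0.
rewrite -[in RHS]vdiv_pair -[f (head O e)]vdiv_pair -sumrB.
by apply: eq_bigr => v _; rewrite -mulrBl !ffunE.
Qed.

(** The transposed incidence matrix turns [f] into its gradient along arcs, so every principal
    divisor becomes a combination of arc boundaries. *)
Lemma sum_laplacian O (f : vert G -> int) :
  \sum_v laplacian_col v *~ f v =
  \sum_e boundary O e *~ (f (tail O e) - f (head O e)).
Proof.
apply/ffunP => u; rewrite !sum_ffunE.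
under eq_bigr => v _
  do rewrite ffunMzE ffunE (laplacian_incidence O) mulrzz mulr_suml.
rewrite exchange_big /=; apply: eq_bigr => e _.
rewrite ffunMzE mulrzz -boundary_pair mulr_sumr.
by apply: eq_bigr => v _; rewrite mulrAC mulrC.
Qed.

(** * Boundaries of directed cycles, paths and cuts *)

Lemma cycle_boundary O c : dicycle O c ->
  \sum_(e in [set e in c]) boundary O e = 0.
Proof.
case: c => [|a c] // /and3P[_ cyc uniq_c].
rewrite big_set -big_uniq ?(map_uniq uniq_c) //= sumrB; apply/eqP.
rewrite subr_eq0 -(big_map (tail O) xpredT (@vdiv G)).
rewrite -(big_map (head O) xpredT (@vdiv G)).
(* The heads along a directed cycle are its tails rotated by one, so both sums run over the same
   vertices. *)
have -> : map (head O) (a :: c) = rot 1 (map (tail O) (a :: c)).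
  rewrite /= rot1_cons; move: cyc; rewrite /cycle /=.
  (* The current edge is generalized, while the closing edge [a] stays fixed. *)
  elim: c {1 3}a {uniq_c} => [|f c IHc] b /=; first by rewrite andbT => /eqP->.
  by case/andP=> /eqP-> /IHc ->.
by apply/eqP/perm_big; rewrite perm_sym perm_rot.
Qed.

(** Consecutive boundaries telescope. *)
Lemma path_boundary O u v p : dipath O u v p ->
  \sum_(e in [set e in p]) boundary O e = vdiv u - vdiv v.
Proof.
case/and3P=> /eqP tl /eqP <- /andP[_ uniq_p].
rewrite big_set -big_uniq ?(map_uniq uniq_p) //= sumrB.
rewrite -(big_map (tail O) xpredT (@vdiv G)).
rewrite -(big_map (head O) xpredT (@vdiv G)).
rewrite tl; elim: (map _ p) u {tl uniq_p} => [|w s IHs] u.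
  by rewrite !big_nil !subrr.
by rewrite !big_cons opprD addrACA IHs addrA subrK.
Qed.

Definition indicator X v : int := (v \in X)%:Z.

Lemma mem_cut O X e : (e \in cut X) = ((tail O e \in X) != (head O e \in X)).
Proof.
have meets Y : (ends e :&: Y != set0) = (tail O e \in Y) || (head O e \in Y).
  apply/set0Pn/orP => [[v]|[]].
  - by rewrite (ends_arc O) !inE => /andP[/orP[]/eqP->]; auto.
  - by exists (tail O e); rewrite (ends_arc O) !inE eqxx.
  by exists (head O e); rewrite (ends_arc O) !inE eqxx orbT.
by rewrite inE !meets !inE; do 2!case: (_ \in X).
Qed.

(** All cut arcs leave [X], so the gradient of its indicator is 1 on the cut and 0 elsewhere. *)
Lemma cut_boundary O X : dicut O X ->
  \sum_(e in cut X) boundary O e = \sum_v laplacian_col v *~ indicator X v.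
Proof.
case/and3P=> _ _ /forall_inP tX; rewrite (sum_laplacian O) big_mkcond.
apply: eq_bigr => e _; have := tX e; rewrite (mem_cut O) /indicator.
by case: (tail O e \in X); case: (head O e \in X) => //= /(_ isT).
Qed.

(** * Reversals preserve linear equivalence classes *)

Lemma move_principal O O' : move O O' ->
  orientation_divisor O' - orientation_divisor O \in @principal G.
Proof.
case/orP=> [/asboolP[c cyc ->]|/existsP[X /andP[cX /eqP->]]];
  rewrite orientation_divisor_reverse addrC addKr.
  by rewrite cycle_boundary // rpred0.
by apply/asboolP; exists (indicator X); apply: cut_boundary.
Qed.

Lemma div_class_eq (D D' : divisor G) :
  (div_class D == div_class D') = (D - D' \in @principal G).
Proof. by rewrite eqmodE. Qed.

Lemma reversal_equiv_div_class O O' : reversal_equiv O O' ->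
  div_class (orientation_divisor O) = div_class (orientation_divisor O').
Proof.
case/connectP => s + ->; elim: s O => //= O1 s IHs O /andP[mv /IHs <-].
apply/eqP; case/orP: mv => /move_principal; first rewrite eq_sym;
  by rewrite div_class_eq.
Qed.

(** * Linear equivalence implies reversal equivalence *)

Lemma reversal_equiv_move O O' : move O O' -> reversal_equiv O O'.
Proof. by move=> mv; apply: connect1; rewrite /= mv. Qed.

Lemma reversal_equiv_trans O1 O2 O3 :
  reversal_equiv O1 O2 -> reversal_equiv O2 O3 -> reversal_equiv O1 O3.
Proof. exact: connect_trans. Qed.

(* A finite nonempty edge set in which every head is again a tail contains a
   directed cycle: iterate the choice of a continuing edge until it loops. *)
Lemma dicycle_exists O S e : e \in S ->
  (forall f, f \in S -> exists2 g, g \in S & tail O g = head O f) ->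
  exists2 c, dicycle O c & {subset c <= S}.
Proof.
move=> eS nextS; pose out v := odflt e [pick g in S | tail O g == v].
have outP f : f \in S ->
    out (head O f) \in S /\ tail O (out (head O f)) = head O f.
  case/nextS => g gS tg; rewrite /out.
  case: pickP => [h /andP[? /eqP]|/(_ g)] //=.
  by rewrite gS tg eqxx.
pose step f := out (head O f).
have iter_in n : iter n step e \in S by elim: n => //= n /outP[].
have [f fS [k fk]] : exists2 f, f \in S & exists k, iter k.+1 step f = f.
  (* Pigeonhole: one more iterate than there are edges. *)
  have /injectivePn[i [j ij eq_ij]] :
      ~~ injectiveb (fun i : 'I_#|edge G|.+1 => iter i step e).
    by apply/negP => /injectiveP /leq_card; rewrite card_ord ltnn.
  wlog lt_ij : i j ij eq_ij / (i < j)%N.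
    by move=> W; case: (ltngtP i j) => [/W|/W|/val_inj ijE]; 
      [apply | apply; rewrite // eq_sym | rewrite ijE eqxx in ij].
  exists (iter i step e) => //; exists (j - i.+1)%N.
  by rewrite -iterD addSn -addnS subnK.
have iterf_in n : iter n step f \in S by elim: n => //= n /outP[].
(* On the orbit an edge is recovered from its tail by [out], so distinct edges have distinct
   tails. *)
have tail_out n : out (tail O (iter n step f)) = iter n step f.
  have -> : iter n step f = step (iter (n + k)%N step f).
    by rewrite -iterS -addnS iterD fk.
  by have [_ ->] := outP _ (iterf_in (n + k)%N).
have orbitP g : g \in orbit step f -> exists n, g = iter n step f.
  by rewrite -fconnect_orbit => /iter_findex <-; exists (findex step f g).
exists (orbit step f); last by move=> g /orbitP[n ->].
apply/and3P; split.
- by rewrite -size_eq0 size_orbit -lt0n order_gt0.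
- have : fcycle step (orbit step f) by apply/(orbitPcycle 0 3); exists k.
  apply: sub_in_cycle (allss (orbit step f)) => g h /orbitP[n ->] _ /eqP <-.
  by have [_ ->] := outP _ (iterf_in n).
rewrite map_inj_in_uniq ?orbit_uniq // => _ _ /orbitP[n ->] /orbitP[m ->].
by move=> /(congr1 out); rewrite !tail_out.
Qed.

Lemma boundary_reverse_notin O S e : e \notin S ->
  boundary (reverse O S) e = boundary O e.
Proof. by move=> /negPf eS; rewrite /boundary tail_reverse head_reverse eS. Qed.

(** Induction on the size of [S]: a directed cycle inside [S] has zero boundary, so reversing it
    leaves a smaller balanced set. *)
Lemma reverse_closed_equiv O S :
  \sum_(e in S) boundary O e = 0 -> reversal_equiv O (reverse O S).
Proof.
have [n leSn] := ubnP #|S|; elim: n => // n IHn in O S leSn *.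
have [->|/set0Pn[e eS]] := eqVneq S set0.
  move=> _; have -> : reverse O set0 = O; last exact: connect0.
  by apply: orientation_inj => e; rewrite ?(tail_reverse, head_reverse) inE.
move=> bS0; have nextS f : f \in S -> exists2 g, g \in S & tail O g = head O f.
  (* If no edge of [S] left the head of [f], the total boundary there would be negative: [f]
     contributes -1 and no other edge is positive. *)
  move=> fS; apply: contrapT => noS.
  have ntail g : g \in S -> head O f == tail O g = false.
    by move=> gS; apply/eqP => hf; apply: noS; exists g.
  move/(congr1 (fun D : divisor G => D (head O f))): bS0.
  rewrite sum_ffunE (bigD1 f fS) /= !ffunE ntail // eqxx sub0r => /eqP.
  rewrite addrC subr_eq0 => /eqP sum1.
  have : \sum_(g in S | g != f) boundary O g (head O f) <= 0.
    by apply: sumr_le0 => g /andP[gS _]; rewrite !ffunE ntail // sub0r oppr_le0.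
  by rewrite sum1.
have [c cyc sub_c] := dicycle_exists eS nextS.
have subC : [set f in c] \subset S by apply/subsetP => f; rewrite inE => /sub_c.
apply: (@reversal_equiv_trans _ (reverse O [set f in c])).
  by apply/reversal_equiv_move/orP; left; apply/asboolP; exists c.
rewrite -(reverse_sub O subC); apply: IHn.
  rewrite cardsD (setIidPr subC) -ltnS; apply: leq_trans leSn; rewrite ltnS.
  rewrite ltn_subrL; apply/andP; split; last by apply/card_gt0P; exists e.
  case/and3P: cyc; case: (c) => // f c' _ _ _.
  by apply/card_gt0P; exists f; rewrite !inE eqxx.
rewrite (eq_bigr (boundary O)) => [|f]; last first.
  by rewrite inE => /andP[/boundary_reverse_notin].
move: bS0; rewrite (big_setID [set f in c]) /= (setIidPr subC).
by rewrite cycle_boundary // add0r.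
Qed.

(* Pairing [D' - D] with [f] compares the sum of the gradient of [f] over the
   reversed edges with the sum of its squares over all edges; as the gradient
   is an integer, equality forces it to be 0 or 1 on every edge. *)
Lemma gradient01 O S (f : vert G -> int) :
  \sum_(e in S) boundary O e = \sum_v laplacian_col v *~ f v ->
  forall e, 0 <= f (tail O e) - f (head O e) <= 1.
Proof.
set x := fun e => f (tail O e) - f (head O e).
have pairing (c : edge G -> int) :
    \sum_v (\sum_e boundary O e *~ c e) v * f v = \sum_e c e * x e.
  under eq_bigr => v _ do rewrite sum_ffunE mulr_suml.
  rewrite exchange_big; apply: eq_bigr => e _ /=.
  under eq_bigr => v _ do rewrite ffunMzE mulrzz mulrAC.
  by rewrite -mulr_suml boundary_pair mulrC.
rewrite (sum_laplacian O) big_mkcond /=.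
rewrite (eq_bigr (fun e => boundary O e *~ (e \in S)%:Z)); last first.
  by move=> e _; case: ifP.
move=> eqD.
have sum0 : \sum_e (x e * x e - (e \in S)%:Z * x e) = 0.
  by rewrite sumrB -!pairing eqD subrr.
have ge0 (s : bool) (y : int) : 0 <= y * y - s%:Z * y.
  by case: s; (have [?|?] : y <= 0 \/ 1 <= y by lia); nia.
have eq0 (s : bool) (y : int) : y * y - s%:Z * y = 0 -> 0 <= y <= 1.
  case: s; (have [?|[?|?]] : y <= -1 \/ 2 <= y \/ 0 <= y <= 1 by lia); nia.
move=> e; apply: (eq0 (e \in S)).
exact: (psumr_eq0P (fun e _ => ge0 (e \in S) (x e)) sum0 (i := e) isT).
Qed.

Lemma principal_equiv O O' (f : vert G -> nat) q : f q = 0%N ->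
  orientation_divisor O' - orientation_divisor O =
    \sum_v laplacian_col v *~ (f v)%:Z ->
  reversal_equiv O O'.
Proof.
move=> fq0; have [n leSn] := ubnP (\sum_v f v)%N.
elim: n => // n IHn in O f fq0 leSn *; move=> eqD.
have [S defO'] := reverse_exists O O'.
have bS : \sum_(e in S) boundary O e = \sum_v laplacian_col v *~ (f v)%:Z.
  by rewrite -eqD defO' orientation_divisor_reverse addrC addKr.
have [[v fv]|f0] := pselect (exists v, (0 < f v)%N); last first.
  rewrite defO'; apply: reverse_closed_equiv; rewrite bS big1 // => v _.
  by have [->|fv] := posnP (f v); last by case: f0; exists v.
pose X := [set v | (0 < f v)%N].
have cutX : dicut O X.
  apply/and3P; split; [by apply/set0Pn; exists v; rewrite inE| |].
    by apply/set0Pn; exists q; rewrite !inE fq0.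
  (* Since [f] never increases along an arc, no arc enters [X]. *)
  apply/forall_inP => e; rewrite (mem_cut O) !inE.
  by have := gradient01 bS e; lia.
apply: (@reversal_equiv_trans _ (reverse O (cut X))).
  apply/reversal_equiv_move/orP; right; apply/existsP; exists X.
  by rewrite cutX eqxx.
(* The truncated predecessor subtracts exactly the indicator of [X] and keeps the zero at [q]. *)
apply: (IHn _ (fun v => (f v).-1)); first by rewrite fq0.
  rewrite -ltnS; apply: leq_trans leSn; rewrite ltnS.
  rewrite (bigD1 v) // [X in (_ < X)%N](bigD1 v) //= -addSn prednK // leq_add2l.
  by apply: leq_sum => u _; apply: leq_pred.
rewrite orientation_divisor_reverse (cut_boundary cutX) opprD addrA eqD -sumrB.
apply: eq_bigr => u _; rewrite -mulrzBr; congr (_ *~ _).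
by rewrite /indicator inE; case: (f u) => //= m; rewrite subr0 || lia.
Qed.

(** * Representatives connected from a given vertex *)

Definition arcrel O : rel (vert G) :=
  [rel u v | [exists e, (tail O e == u) && (head O e == v)]].

Lemma connect_dipath O u v : connect (arcrel O) u v -> exists p, dipath O u v p.
Proof.
case/connectP=> s0 /shortenP[s path_s uniq_s _ ->] {s0 v}.
have [p [tl hd]] : exists p,
    [seq tail O e | e <- p] = belast u s /\ [seq head O e | e <- p] = s.
  elim: s u path_s {uniq_s} => [|w s IHs] u /=; first by exists [::].
  case/andP=> /existsP[e /andP[/eqP te /eqP he]] /IHs[p [tl hd]].
  by exists (e :: p) => /=; rewrite te he tl hd.
by exists p; rewrite /dipath tl hd uniq_s !eqxx.
Qed.

Definition reachable O q := [set v | connect (arcrel O) q v].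

(** Induction on the number of unreachable vertices. Reversing the cut around the reachable set [R]
    leaves the arcs inside [R] alone and makes some arc lead out of [R], so the reachable set grows
    strictly. *)
Lemma exists_qconnected q O : connected G ->
  exists2 O', qconnected q O' & reversal_equiv O O'.
Proof.
case=> _ connG; have [n leRn] := ubnP #|~: reachable O q|.
elim: n => // n IHn in O leRn *.
set R := reachable O q in leRn *.
have [XE|X0] := eqVneq (~: R) set0.
  exists O; last exact: connect0.
  move=> v; apply: connect_dipath; have : v \notin ~: R by rewrite XE inE.
  by rewrite !inE negbK.
have qR : q \in R by rewrite inE connect0.
have arcR e : tail O e \in R -> head O e \in R.
  rewrite !inE => /connect_trans; apply; apply: connect1.
  by apply/existsP; exists e; rewrite !eqxx.
(* No arc leaves [R]; as [dicut] wants tails inside its set, the complement is used. *)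
have cutX : dicut O (~: R).
  apply/and3P; split=> //; first by apply/set0Pn; exists q; rewrite setCK.
  apply/forall_inP => e; rewrite (mem_cut O) !in_setC.
  by have := arcR e; case: (tail O e \in R) => // /(_ isT) ->.
pose O1 := reverse O (cut (~: R)).
have subR : R \subset reachable O1 q.
  apply/subsetP => v; rewrite inE => /connectP[s path_s ->].
  suff: forall u, u \in R -> u \in reachable O1 q -> path (arcrel O) u s ->
    last u s \in reachable O1 q by apply; rewrite // inE connect0.
  elim: s {path_s} => //= w s IHs u uR uR1.
  case/andP=> /existsP[e /andP[/eqP te /eqP he]] path_s.
  have wR : w \in R by rewrite -he arcR // te.
  apply: IHs => //; rewrite inE; rewrite inE in uR1; apply: connect_trans uR1 _.
  have ncut : e \in cut (~: R) = false.
    by rewrite (mem_cut O) te he !in_setC uR wR.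
  apply/connect1/existsP; exists e.
  by rewrite tail_reverse head_reverse ncut te he !eqxx.
(* With an empty cut, [R] would be closed under adjacency and hence contain every vertex. *)
have [e cut_e] : exists e, e \in cut (~: R).
  apply: contrapT => ncut; case/set0Pn: X0 => v; rewrite inE => /negP; apply.
  rewrite -(closed_connect _ (connG q v)) // => u w /existsP[e /eqP eE].
  have tailR x : x \in ends e -> (x \in R) = (tail O e \in R).
    rewrite (ends_arc O) in_set2 => /orP[]/eqP-> //.
    apply/eqP/negPn/negP => ne; case: ncut; exists e.
    by rewrite (mem_cut O) !in_setC (inj_eq negb_inj) eq_sym.
  by rewrite !tailR // eE ?set21 ?set22.
have [O' qO' eqO'] : exists2 O', qconnected q O' & reversal_equiv O1 O'.
  apply: IHn; rewrite -ltnS; apply: leq_trans leRn; rewrite ltnS.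
  apply: proper_card; rewrite properC; apply/properP; split=> //.
  have tX : tail O e \notin R.
    by have /and3P[_ _ /forall_inP/(_ e cut_e)] := cutX; rewrite inE.
  exists (tail O e) => //; have := cut_e; rewrite (mem_cut O) !in_setC tX.
  case: (boolP (head O e \in R)) => // hR _; have := subsetP subR _ hR.
  rewrite !inE => /connect_trans; apply; apply/connect1/existsP; exists e.
  by rewrite tail_reverse head_reverse cut_e !eqxx.
exists O' => //; apply: reversal_equiv_trans eqO'.
apply/reversal_equiv_move/orP; right; apply/existsP; exists (~: R).
by rewrite cutX eqxx.
Qed.

(** * The map from reversal classes to the Picard group *)

Lemma orientation_pic_eq (q : vert G) O O' :
  reversal_equiv O O' <-> orientation_pic O = orientation_pic O'.
Proof.
split=> [eqO|]; first exact/val_inj/reversal_equiv_div_class.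
move=> /(congr1 sval) /= /esym/eqP; rewrite div_class_eq => /asboolP[f eqf].
case: (@arg_minP _ _ _ q xpredT f isT) => m _ min_m.
(* Subtracting the minimum leaves the gradient, hence the Laplacian, unchanged; the shifted function
   is nonnegative, so the absolute value only changes its type. *)
apply: (principal_equiv (f := fun v => `|f v - f m|%N) (q := m)).
  by rewrite subrr.
rewrite eqf !(sum_laplacian O); apply: eq_bigr => e _; congr (_ *~ _).
by rewrite !gez0_abs ?subr_ge0 ?min_m // opprB addrA subrK.
Qed.

Lemma orientation_pic_path O u v p : dipath O u v p ->
  orientation_pic (reverse O [set e in p]) =
  pic_act (vdiff u v) (orientation_pic O).
Proof.
move=> path_p; apply: val_inj; rewrite /= -div_classD; congr div_class.
by rewrite orientation_divisor_reverse (path_boundary path_p) addrC.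
Qed.

End Orientations.

(** * Generators of degree 0 and the action on degree [d] classes *)

Section Pic.
Variable G : multigraph.

(** A divisor [D] of degree 0 is the sum of the [D v] multiples of (v) - (q): the terms in (q) add
    up to the degree. *)
Lemma vdiff_ind (q : vert G) (P : Pic0 G -> Prop) :
  P 0 -> (forall a b, P a -> P b -> P (a + b)) ->
  (forall u v, P (vdiff u v)) -> forall a, P a.
Proof.
move=> P0 PD Pvdiff a; have /asboolP[D degD0 DE] := valP a.
have PM b n : P b -> P (b *+ n).
  by move=> Pb; elim: n => [|n IHn]; rewrite ?mulr0n // mulrS; apply: PD.
have vdiffN (u v : vert G) : - vdiff u v = vdiff v u.
  by apply: val_inj; rewrite /= -raddfN opprB.
have PMz u v (z : int) : P (vdiff u v *~ z).
  case: z => n; first by rewrite -pmulrn; apply: PM.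
  by rewrite NegzE mulrNz -mulNrz vdiffN -pmulrn; apply: PM.
have -> : a = \sum_v vdiff v q *~ D v; last first.
  by apply: big_ind.
have valMz (b : Pic0 G) (z : int) : sval (b *~ z) = sval b *~ z.
  exact: (raddfMz (val : {additive Pic0 G -> picard G})).
have div_classMz (E : divisor G) (z : int) :
    div_class E *~ z = div_class (E *~ z).
  exact/esym/(raddfMz (\pi_(picard G)%qT : {additive divisor G -> picard G})).
apply: val_inj; rewrite raddf_sum /= -DE.
under eq_bigr => v _ do rewrite valMz /= div_classMz.
rewrite -(big_morph _ (@div_classD G) (raddf0 _)); congr div_class.
under eq_bigr => v _ do rewrite mulrzBl.
rewrite sumrB -mulrz_sumr -/(deg D) degD0 mulr0z subr0.
apply/ffunP => u; rewrite sum_ffunE (bigD1 u) //= big1.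
  by rewrite ffunMzE ffunE eqxx addr0 mulrzz mul1r.
by move=> v /negPf vu; rewrite ffunMzE ffunE eq_sym vu mul0rz.
Qed.

Lemma pic_actA d (a b : Pic0 G) (x : Pic G d) :
  pic_act (a + b) x = pic_act a (pic_act b x).
Proof. by apply: val_inj; rewrite /= addrA. Qed.

Lemma pic_act0 d (x : Pic G d) : pic_act 0 x = x.
Proof. by apply: val_inj; rewrite /= add0r. Qed.

Lemma pic_act_transitive d (x y : Pic G d) : exists! a, pic_act a x = y.
Proof.
have rep (z : Pic G d) : exists2 D, deg D = d & div_class D = sval z.
  by case: z => z /= /asboolP.
have [D dD xE] := rep x; have [D' dD' yE] := rep y.
have degDD : deg (D' - D) = 0 by rewrite degB dD dD' subrr.
exists (pic_class degDD); split=> [|a ay].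
  by apply: val_inj; rewrite /= div_classB xE yE subrK.
by apply: val_inj; rewrite /= div_classB xE yE -ay /= addrK.
Qed.

Lemma orientation_pic_surj (q : vert G) (x : Pic G (genus G - 1)) :
  connected G -> exists O, orientation_pic O = x.
Proof.
move=> connG; have [O0] := orientation_exists G.
have [a [<- _]] := pic_act_transitive (orientation_pic O0) x.
(* The induction ranges over all starting orientations, because a sum acts in two successive
   steps. *)
move: {x} a O0; apply: (vdiff_ind q) => [O|a b IHa IHb O|u v O].
- by exists O; rewrite pic_act0.
- have [O1 O1E] := IHb O; have [O2 O2E] := IHa O1.
  by exists O2; rewrite O2E O1E pic_actA.
have [O1 conn_u /(orientation_pic_eq u) ->] := exists_qconnected u O connG.
have [p path_p] := conn_u v.
by exists (reverse O1 [set e in p]); apply: orientation_pic_path.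
Qed.

End Pic.

(** * Transport of the action to orientation classes *)

Theorem theorem1p5 (G : multigraph) (Gconn : connected G) :
  (forall (q : vert G) (x : orientation_class G),
     exists2 O, qconnected q O & or_class O = x) /\
  exists act : Pic0 G -> orientation_class G -> orientation_class G,
    [/\ path_reversal_action act,
        forall act', path_reversal_action act' -> forall a x, act' a x = act a x,
        torsor act,
        torsor (@pic_act G (genus G - 1)%R)
      & exists phi : orientation_class G -> Pic G (genus G - 1)%R,
          (forall O, phi (or_class O) = orientation_pic O) /\
          torsor_iso act (@pic_act G (genus G - 1)%R) phi].
Proof.
have or_class_eq (O O' : orientation G) :
    or_class O = or_class O' <-> reversal_equiv O O'.
  by split=> /eqmodP.
have qconn_rep (q : vert G) (x : orientation_class G) :
    exists2 O, qconnected q O & or_class O = x.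
  have [O1 conn_q eqO] := exists_qconnected q (repr x) Gconn.
  by exists O1 => //; rewrite -[x]reprK; apply/esym/or_class_eq.
split=> //; have [/card_gt0P[q _] _] := Gconn.
pose phi (x : orientation_class G) := orientation_pic (repr x).
have phiE (O : orientation G) : phi (or_class O) = orientation_pic O.
  by apply/(orientation_pic_eq q)/or_class_eq; rewrite /or_class reprK.
have phi_inj : injective phi.
  move=> x y /(orientation_pic_eq q)/or_class_eq; rewrite /or_class !reprK.
  exact.
have /choice[psi psiK] : forall y, exists x, phi x = y.
  move=> y; have [O <-] := orientation_pic_surj q y Gconn.
  by exists (or_class O).
have phiK : cancel phi psi by move=> x; apply: phi_inj; rewrite psiK.
(* The action is carried over from the Picard side through the bijection [phi], so its torsor axioms
   can be checked there. *)
pose act a x := psi (pic_act a (phi x)).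
have phi_act a x : phi (act a x) = pic_act a (phi x) by apply: psiK.
have act_action : group_action act.
  split=> [x|a b x]; apply: phi_inj; rewrite !phi_act ?pic_act0 //.
  exact: pic_actA.
have act_path : path_reversal_action act.
  split=> // u v O s _ path_s.
  by apply: phi_inj; rewrite phi_act !phiE (orientation_pic_path path_s).
have [O0] := orientation_exists G.
exists act; split=> //.
- move=> act' [[act'0 act'D] act'_path] a; have [act0 actD] := act_action.
  (* Uniqueness is checked on generators: each class has a [u]-connected representative, and a path
     in it from [u] to [v] determines the value. *)
  move: a; apply: (vdiff_ind q) => [x|a b IHa IHb x|u v x].
  + by rewrite act'0 act0.
  + by rewrite act'D actD IHb IHa.
  have [O conn_u <-] := qconn_rep u x; have [p path_p] := conn_u v.
  rewrite (act'_path _ _ _ _ conn_u path_p).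
  by rewrite (act_path.2 _ _ _ _ conn_u path_p).
- split=> // [|x y]; first by split; exact: or_class O0.
  have [a [actx uniq_a]] := pic_act_transitive (phi x) (phi y).
  exists a; split=> [|b bx]; first by apply: phi_inj; rewrite phi_act.
  by apply: uniq_a; rewrite -phi_act bx.
- split; [|by split; exact: orientation_pic O0|exact: pic_act_transitive].
  by split; [exact: pic_act0 | exact: pic_actA].
by exists phi; split=> //; split=> //; exists psi.
Qed.
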